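(* Let $\{X_{\mathtt{i}}:\mathtt{i}\in I^*\}$ be a weakly controlled Moran construction in a metric space $M$, with limit set $E$ and topological pressure $P$. Assume that the finite clustering property holds and that $t\ge0$ satisfies $P(t)\ge0$. Then $\mathcal{H}^t(E)>0$. Moreover, $\mathcal{H}^t(E)<\infty$ if and only if $M^t(I^\infty)<\infty$.
   Context: Words: $I$ is an index set with $2\le\#I<\infty$; $I^*=\bigcup_{n\ge1}I^n$, $I^\infty=I^{\mathbb{N}}$; $|\mathtt{i}|$ is the length of a word; $\mathtt{i}\mathtt{j}$ is concatenation; $\mathtt{i}|_n$ is the initial segment of length $n$; $\mathtt{i}^-=\mathtt{i}|_{|\mathtt{i}|-1}$ (for $|\mathtt{i}|\ge2$; conditions involving $\mathtt{i}^-$ concern such words); $[\mathtt{i}]\subset I^\infty$ is the set of infinite words beginning with $\mathtt{i}$. Weakly controlled Moran construction (WCMC): a collection $\{X_{\mathtt{i}}:\mathtt{i}\in I^*\}$ of compact subsets of $M$ with positive diameter for which there is $D\ge1$ such that for all $\mathtt{i},\mathtt{j}\in I^*$: (W1) $X_{\mathtt{i}}\subset X_{\mathtt{i}^-}$; (W2) there is $n\in\mathbb{N}$ with $\max_{\mathtt{i}\in I^n}\operatorname{diam}(X_{\mathtt{i}})<D^{-1}$; (W3) $\operatorname{diam}(X_{\mathtt{i}\mathtt{j}})\le D\operatorname{diam}(X_{\mathtt{i}})\operatorname{diam}(X_{\mathtt{j}})$; (W4) $\operatorname{diam}(X_{\mathtt{i}})\ge D^{-1}\operatorname{diam}(X_{\mathtt{i}^-})$.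 The projection $\pi:I^\infty\to M$ is given by $\{\pi(\mathtt{i})\}=\bigcap_{n\ge1}X_{\mathtt{i}|_n}$ and the limit set is $E=\pi(I^\infty)$. The topological pressure is $P(t)=\lim_{n\to\infty}\frac1n\log\sum_{\mathtt{i}\in I^n}\operatorname{diam}(X_{\mathtt{i}})^t$ for $t\ge0$. $Z(r)=\{\mathtt{i}\in I^*:\operatorname{diam}(X_{\mathtt{i}})\le r<\operatorname{diam}(X_{\mathtt{i}^-})\}$ and $Z(x,r)=\{\mathtt{i}\in Z(r):X_{\mathtt{i}}\cap B(x,r)\neq\emptyset\}$, where $B(x,r)$ is the open ball. Finite clustering property: $\sup_{x\in E}\limsup_{r\downarrow0}\#Z(x,r)<\infty$. For $A\subset I^\infty$, $M^t_n(A)=\inf\{\sum_{\mathtt{i}\in C}\operatorname{diam}(X_{\mathtt{i}})^t: C\subset I^*,\ A\subset\bigcup_{\mathtt{i}\in C}[\mathtt{i}],\ |\mathtt{i}|\ge n\text{ for all }\mathtt{i}\in C\}$ and $M^t(A)=\lim_{n\to\infty}M^t_n(A)$. $\mathcal{H}^t$ is the $t$-dimensional Hausdorff measure, $\mathcal{H}^t(E)=\lim_{\delta\to0}\inf\{\sum_i\operatorname{diam}(A_i)^t:E\subset\bigcup_iA_i,\ \operatorname{diam}(A_i)<\delta\}$ for $t>0$; $\mathcal{H}^0$ is counting measure. *)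

(* Defs.v *)
From HB Require Import structures.
From mathcomp Require Import all_boot all_order all_algebra.
From mathcomp Require Import all_classical all_reals all_analysis.
Set Implicit Arguments.
Unset Strict Implicit.
Unset Printing Implicit Defensive.
Import Order.TTheory GRing.Theory Num.Theory.
Import numFieldNormedType.Exports.
Local Open Scope classical_set_scope.
Local Open Scope ring_scope.
Local Open Scope ereal_scope.

Section metric.
Context {R : realType} {M : metricType R}.

(* The maximum with 0 only matters for the empty set, whose supremum is -oo. *)
Definition diam (A : set M) : \bar R :=
  maxe 0 (ereal_sup [set (mdist p.1 p.2)%:E | p in A `*` A]).

(* Finite covers are included, by padding with the empty set: diam set0 = 0 and
   0 `^ t = 0 for t > 0. *)
Definition hausdorff_content (t delta : R) (E : set M) : \bar R :=
  ereal_inf [set \sum_(0 <= k <oo) diam (A k) `^ t |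
    A in [set A : nat -> set M |
      E `<=` \bigcup_k A k /\ forall k, diam (A k) < delta%:E]].

Definition hausdorff_measure (t : R) (E : set M) : \bar R :=
  if t == 0%R then counting E
  else lim (hausdorff_content t delta E @[delta --> 0^'+]).

End metric.

Section words.
Context {I : finType}.

Definition parent (i : seq I) : seq I := take (size i).-1 i.

Definition prefix_word (w : nat -> I) (n : nat) : seq I := mkseq w n.

Definition cylinder (i : seq I) : set (nat -> I) :=
  [set w | prefix_word w (size i) = i].

Definition finite_words : set (seq I) := [set i | (0 < size i)%N].

End words.

(* A family indexed by I^* is encoded as X : seq I -> set M, where I^* consists
   of the nonempty sequences; the value X [::] is never used. *)
Section moran.
Context {R : realType} {M : metricType R} {I : finType}.
Implicit Types (X : seq I -> set M) (t r : R).

Definition wcmc X : Prop :=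
  (forall i, finite_words i -> compact (X i) /\ 0 < diam (X i)) /\
  exists D : R, (1 <= D)%R /\
  [/\ forall i, (1 < size i)%N -> X i `<=` X (parent i),
      exists n, (0 < n)%N /\
        \big[maxe/-oo]_(i : n.-tuple I) diam (X i) < (D^-1)%:E,
      forall i j, finite_words i -> finite_words j ->
        diam (X (i ++ j)) <= D%:E * diam (X i) * diam (X j)
    & forall i, (1 < size i)%N -> (D^-1)%:E * diam (X (parent i)) <= diam (X i)].

(* The graph of the projection pi, i.e. x = pi(w). *)
Definition projects_to X (w : nat -> I) (x : M) : Prop :=
  \bigcap_(n in [set n | (1 <= n)%N]) X (prefix_word w n) = [set x].

Definition limit_set X : set M := [set x | exists w, projects_to X w x].

(* For a weakly controlled Moran construction the sum is a positive real number,
   so fine loses nothing, and the limit exists in R: the logarithms of the sums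
   are subadditive up to a constant, and the lower bound of diam (X i) in terms
   of diam (X (parent i)) bounds them below by a linear function of n. *)
Definition pressure X t : R :=
  limn (fun n => n%:R^-1 * ln (fine (\sum_(i : n.-tuple I) diam (X i) `^ t)))%R.

Definition Zr X r : set (seq I) :=
  [set i | (1 < size i)%N /\ diam (X i) <= r%:E < diam (X (parent i))].

Definition Zxr X (x : M) r : set (seq I) :=
  [set i | Zr X r i /\ X i `&` ball x r !=set0].

Definition finite_clustering X : Prop :=
  ereal_sup [set limf_esup (fun r : R => counting (Zxr X x r) : \bar R) 0^'+ |
    x in limit_set X] < +oo.

Definition Mtn X t (n : nat) (A : set (nat -> I)) : \bar R :=
  ereal_inf [set \esum_(i in C) diam (X i) `^ t |
    C in [set C : set (seq I) | [/\ C `<=` finite_words,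
      A `<=` \bigcup_(i in C) cylinder i
      & forall i, C i -> (n <= size i)%N]]].

Definition Mt X t (A : set (nat -> I)) : \bar R := limn (fun n => Mtn X t n A).

End moran.

(* Main.v *)
Require Import Defs.
From HB Require Import structures.
From mathcomp Require Import all_boot all_order all_algebra.
From mathcomp Require Import all_classical all_reals all_analysis.
From mathcomp Require Import zify lra.
Import Order.TTheory GRing.Theory Num.Theory.
Import numFieldNormedType.Exports.
Local Open Scope classical_set_scope.
Local Open Scope ring_scope.
Local Open Scope ereal_scope.
Set Implicit Arguments.
Unset Strict Implicit.

(** The net measure [Mt] is an outer measure for which cylinders are
    Caratheodory measurable.  Submultiplicativity and [P(t) >= 0] give
    [\sum_(|i| = n) diam (X i) ^ t >= D ^ -t] for all [n >= 1] (Fekete), and a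
    cover by cylinders, finite by compactness, with too small a sum would make
    these sums decay to 0; hence [Mt X t setT >= D ^ -t > 0].  On the other
    hand [Mt X t setT <= N * H^t(E)]: on the set [tame N k] of words whose
    projection [x] satisfies [#Z(x, r) <= N] for all [r < 1/(k+1)], a cover of
    [E] by small sets is replaced by balls, and each ball by the at most [N]
    cylinders of [Z(x, r)].  The sets [tame N k] are closed and increase to the
    whole space, so continuity from below of the net measure concludes.  For
    [t > 0] the bound [H^t(E) <= Mt X t setT] is immediate, and for [t = 0] both
    quantities are infinite. *)

(** * Sums over arbitrary sets, outer measures and prefixes *)

Lemma le_esum_set (R : realType) (T : choiceType) (A B : set T)
    (a : T -> \bar R) :
  (forall i, B i -> 0 <= a i) -> A `<=` B ->
  \esum_(i in A) a i <= \esum_(i in B) a i.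
Proof.
move=> a0 AB; rewrite (esumID A B)// setIC (setIidl AB).
by rewrite leeDl// esum_ge0// => i [/a0].
Qed.

(** Choosing for every element of the union one index [k] whose [J k] contains it embeds the union
    into the disjoint union of the sets [J k], over which the iterated sum runs. *)
Lemma esum_bigcup_le (R : realType) (T T' : choiceType) (K : set T)
    (J : T -> set T') (a : T' -> \bar R) : (forall x, 0 <= a x) ->
  \esum_(i in \bigcup_(k in K) J k) a i <= \esum_(k in K) \esum_(j in J k) a j.
Proof.
move=> a0; rewrite esum_esum//.
have [h hP] : {h : T' -> option T & forall i, (\bigcup_(k in K) J k) i ->
    exists2 k, h i = Some k & K k /\ J k i}.
  apply: (@choice _ _ (fun i o => (\bigcup_(k in K) J k) i ->
    exists2 k, o = Some k & K k /\ J k i)) => i.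
  have [[k Kk Jk]|nU] := pselect ((\bigcup_(k in K) J k) i); last by exists None.
  by exists (Some k) => _; exists k.
have [->|/set0P[i0 /hP[k0 _ _]]] := eqVneq (\bigcup_(k in K) J k) set0.
  by rewrite esum_set0 esum_ge0.
pose e i := (odflt k0 (h i), i).
rewrite (_ : \esum_(i in _) a i =
    \esum_(k in e @` (\bigcup_(k in K) J k)) a k.2); last first.
  by rewrite esum_image//; move=> i j _ _ [].
apply: le_esum_set => //.
by move=> _ [i /hP[k hk [Kk Jk]] <-]; rewrite /e hk; split.
Qed.

(** The successive differences [seqD A] are disjoint and measurable, so additivity makes their
    partial sums equal to the values [mu (A n)], and countable subadditivity handles the union. *)
Lemma caratheodory_nondecreasing_bigcup_le (R : realType) (T : Type)
    (mu : {outer_measure set T -> \bar R}) (A : (set T)^nat) (c : \bar R) :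
  (forall n, mu.-caratheodory (A n)) -> nondecreasing_seq A ->
  (forall n, mu (A n) <= c) -> mu (\bigcup_n A n) <= c.
Proof.
move=> mA ndA Ac.
have mB n : mu.-caratheodory (seqD A n).
  by case: n => [|n] //=; exact: caratheodory_measurable_setD.
have tB := trivIset_seqD ndA.
rewrite -eq_bigcup_seqD.
apply: (le_trans (outer_measure_sigma_subadditive mu _)).
apply: lime_le; first by apply: is_cvg_nneseries => k *; exact: outer_measure_ge0.
apply: nearW => -[|n].
  by rewrite big_geq// (le_trans (outer_measure_ge0 mu _) (Ac 0%N)).
rewrite big_mkord; apply: le_trans (Ac n).
have -> : mu (A n) = \sum_(i < n.+1) mu (setT `&` seqD A i).
  by rewrite -caratheodory_additive// setTI nondecreasing_bigsetU_seqD.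
by apply: lee_sum => k _; rewrite setTI.
Qed.

Lemma prefix_word_take (I : finType) (w : nat -> I) m n : (m <= n)%N ->
  take m (prefix_word w n) = prefix_word w m.
Proof.
by move=> mn; rewrite /prefix_word /mkseq -map_take take_iota (minn_idPl mn).
Qed.

(** * The net measure *)

Section net_measure.
Context {R : realType} {M : metricType R} {I : finType}.
Variables (X : seq I -> set M) (t : R).
Implicit Types A B : set (nat -> I).

Lemma le_Mtn n A B : A `<=` B -> Mtn X t n A <= Mtn X t n B.
Proof.
move=> AB; apply: ereal_inf_le_tmp => _ [C [CI BC Cn] <-]; exists C => //.
by split=> //; exact: subset_trans BC.
Qed.

Lemma Mtn_ge0 n A : 0 <= Mtn X t n A.
Proof.
by apply: le_ereal_inf_tmp => _ [C _ <-]; apply: esum_ge0 => i _; exact: poweR_ge0.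
Qed.

Lemma nondecreasing_Mtn A : nondecreasing_seq (fun n => Mtn X t n A).
Proof.
move=> m n mn; apply: ereal_inf_le_tmp => _ [C [CI AC Cn] <-]; exists C => //.
by split=> // i /Cn; exact: leq_trans.
Qed.

Lemma MtE A : Mt X t A = ereal_sup (range (fun n => Mtn X t n A)).
Proof.
exact/cvg_lim/ereal_nondecreasing_cvgn/nondecreasing_Mtn.
Qed.

Lemma Mtn_le_Mt n A : Mtn X t n A <= Mt X t A.
Proof. by rewrite MtE; apply: ereal_sup_ubound; exists n. Qed.

Lemma Mt_le A c : (forall n, Mtn X t n A <= c) -> Mt X t A <= c.
Proof. by move=> h; rewrite MtE; apply: ge_ereal_sup => _ [n _ <-]. Qed.

Lemma Mtn_le_esum n A (C : set (seq I)) : C `<=` finite_words ->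
  A `<=` \bigcup_(i in C) cylinder i -> (forall i, C i -> (n <= size i)%N) ->
  Mtn X t n A <= \esum_(i in C) diam (X i) `^ t.
Proof. by move=> *; apply: ereal_inf_lbound; exists C. Qed.

Lemma Mtn_sigma_subadditive n : sigma_subadditive (Mtn X t n).
Proof.
move=> A; have [[i ioo]|] := pselect (exists i, Mtn X t n (A i) = +oo).
  rewrite (eseries_pinfty _ _ ioo) ?leey// => k _.
  by rewrite -ltNye (lt_le_trans _ (Mtn_ge0 _ _)).
(* When all terms are finite, a cover of [A k] that is optimal up to [e / 2 ^ k.+1] exists for each
   [k]; the union of these covers is admissible for the union. *)
rewrite -forallNE => Aoo; apply/lee_addgt0Pr => e e0.
rewrite (le_trans _ (epsilon_trick _ _ (ltW e0)))//; last first.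
  by move=> k; exact: Mtn_ge0.
have [C CP] : {C : nat -> set (seq I) & forall k, [/\ C k `<=` finite_words,
    A k `<=` \bigcup_(i in C k) cylinder i,
    forall i, C k i -> (n <= size i)%N &
    \esum_(i in C k) diam (X i) `^ t <=
      Mtn X t n (A k) + (e / (2 ^ k.+1)%:R)%:E]}.
  apply: (@choice _ _ (fun k C => [/\ C `<=` finite_words,
    A k `<=` \bigcup_(i in C) cylinder i,
    forall i, C i -> (n <= size i)%N &
    \esum_(i in C) diam (X i) `^ t <=
      Mtn X t n (A k) + (e / (2 ^ k.+1)%:R)%:E])) => k.
  have ek : (0 < e / (2 ^ k.+1)%:R)%R by rewrite divr_gt0// ltr0n expn_gt0.
  have fin : Mtn X t n (A k) \is a fin_num.
    by rewrite ge0_fin_numE ?Mtn_ge0// ltey; exact/eqP/Aoo.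
  have [_ [C [CI AC Cn] <-] /ltW] := lb_ereal_inf_adherent ek fin.
  by exists C.
apply: (@le_trans _ _ (\esum_(i in \bigcup_k C k) diam (X i) `^ t)).
  apply: Mtn_le_esum.
  - by move=> i [k _]; have [+ _ _ _] := CP k; apply.
  - move=> w [k _ Akw]; have [_ /(_ _ Akw) [i Ci iw] _ _] := CP k.
    by exists i => //; exists k.
  - by move=> i [k _]; have [_ _ + _] := CP k; apply.
apply: (le_trans (esum_bigcup_le _ _ _)) => [i|]; first exact: poweR_ge0.
rewrite nneseries_esumT; last first.
  by move=> k; rewrite adde_ge0 ?Mtn_ge0// lee_fin divr_ge0// ltW.
by apply: le_esum => k _; have [] := CP k.
Qed.

Let Mt0 : Mt X t set0 = 0.
Proof.
apply/eqP; rewrite eq_le; apply/andP; split; last first.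
  exact: le_trans (Mtn_ge0 0%N set0) (Mtn_le_Mt _ _).
apply: Mt_le => n; rewrite -[leRHS](esum_set0 (fun i => diam (X i) `^ t)).
exact: Mtn_le_esum.
Qed.

Let Mt_ge0 A : 0 <= Mt X t A.
Proof. exact: le_trans (Mtn_ge0 0%N A) (Mtn_le_Mt _ _). Qed.

Let le_Mt : {homo Mt X t : A B / A `<=` B >-> A <= B}.
Proof.
by move=> A B AB; apply: Mt_le => n; exact: le_trans (le_Mtn n AB) (Mtn_le_Mt _ _).
Qed.

Let Mt_sigma_subadditive : sigma_subadditive (Mt X t).
Proof.
move=> A; apply: Mt_le => n; apply: (le_trans (Mtn_sigma_subadditive _ _)).
by apply: lee_nneseries => k *; [exact: Mtn_ge0|exact: Mtn_le_Mt].
Qed.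

HB.instance Definition _ := isOuterMeasure.Build R (nat -> I) (Mt X t)
  Mt0 Mt_ge0 le_Mt Mt_sigma_subadditive.


Lemma cylinder_take (i : seq I) (w : nat -> I) m : (m <= size i)%N ->
  cylinder i w -> cylinder (take m i) w.
Proof.
rewrite /cylinder/= size_take_min => mi iw.
by rewrite (minn_idPl mi) -[in RHS]iw prefix_word_take.
Qed.

(* For [n >= size i] every admissible covering word of length at least [n] lies
   in, or is disjoint from, the cylinder of [i]. *)
Lemma caratheodory_cylinder (i : seq I) : (Mt X t).-caratheodory (cylinder i).
Proof.
apply: le_caratheodory_measurable => A.
have split_ge n : (size i <= n)%N ->
    Mtn X t n (A `&` cylinder i) + Mtn X t n (A `&` ~` cylinder i)
    <= Mtn X t n A.
  move=> si; apply: le_ereal_inf_tmp => _ [C [CI AC Cn] <-].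
  rewrite (esumID [set u | take (size i) u = i]); last first.
    by move=> *; exact: poweR_ge0.
  apply: leeD.
  - apply: Mtn_le_esum => [u [/CI]//| w [/AC[u Cu uw] iw]|u [/Cn]//].
    exists u => //; split=> //=.
    have su : (size i <= size u)%N := leq_trans si (Cn _ Cu).
    by rewrite -uw prefix_word_take.
  - apply: Mtn_le_esum => [u [/CI]//| w [/AC[u Cu uw] iw]|u [/Cn]//].
    exists u => //; split=> //= ui; apply: iw.
    have su : (size i <= size u)%N := leq_trans si (Cn _ Cu).
    by rewrite -ui; exact: cylinder_take.
(* Both parts are monotone in [n], so the sum of their limits is the limit of their sums, and the
   inequality is only needed for large [n]. *)
have cvgM B : cvgn (fun n => Mtn X t n B).
  exact/ereal_nondecreasing_is_cvgn/nondecreasing_Mtn.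
apply: (@le_trans _ _ (limn (fun n =>
    Mtn X t n (A `&` cylinder i) + Mtn X t n (A `&` ~` cylinder i)))).
  rewrite limeD//; apply: ge0_adde_def; rewrite inE; apply: lime_ge => //;
    by apply: nearW => n; exact: Mtn_ge0.
apply: lime_le.
  by apply: ereal_nondecreasing_is_cvgn => m n mn; apply: leeD;
    exact: nondecreasing_Mtn.
exists (size i) => // n /= si.
exact: le_trans (split_ge _ si) (Mtn_le_Mt _ _).
Qed.

(** The hypothesis says that the complement of [A] is open. There are countably many words, so this
    complement is a countable union of cylinders. *)
Lemma caratheodory_cylinder_closed A :
  (forall w, ~ A w -> exists i, cylinder i w /\ cylinder i `<=` ~` A) ->
  (Mt X t).-caratheodory A.
Proof.
move=> Acl; rewrite -[A]setCK; apply: caratheodory_measurable_setC.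
pose C k := if (unpickle k : option (seq I)) is Some i then
  if pselect (cylinder i `<=` ~` A) then cylinder i else set0 else set0.
rewrite (_ : ~` A = \bigcup_k C k).
  apply: caratheodory_measurable_bigcup => k; rewrite /C.
  case: unpickle => [i|]; last exact: caratheodory_measurable_set0.
  by case: pselect => ?; [exact: caratheodory_cylinder|
    exact: caratheodory_measurable_set0].
apply/seteqP; split=> [w /Acl[i [iw iA]]|w [k _]].
  by exists (pickle i) => //; rewrite /C pickleK; case: pselect.
by rewrite /C; case: unpickle => // i; case: pselect => // iA; exact: iA.
Qed.

End net_measure.

(** * Subadditive sequences and sums over words *)

Lemma fekete (R : realType) (u : nat -> R) (c : R) :
  (forall m n, (0 < m)%N -> (0 < n)%N -> (u (m + n)%N <= u m + u n)%R) ->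
  (forall n, (0 < n)%N -> (c * n%:R <= u n)%R) ->
  let L := inf [set (u n / n%:R)%R | n in [set n | (0 < n)%N]] in
  (u n / n%:R)%R @[n --> \oo] --> L /\
  forall n, (0 < n)%N -> (L * n%:R <= u n)%R.
Proof.
move=> usub ulb.
pose S := [set (u n / n%:R)%R | n in [set n | (0 < n)%N]].
rewrite -/S => L.
have Slb : has_lbound S.
  by exists c => _ [n n0 <-]; rewrite ler_pdivlMr ?ltr0n// ulb.
have Sinf : has_inf S by split=> //; exists (u 1%N / 1%:R)%R, 1%N.
have LS n : (0 < n)%N -> (L <= u n / n%:R)%R by move=> n0; apply: (ge_inf Slb); exists n.
split; last by move=> n n0; rewrite -ler_pdivlMr ?ltr0n// LS.
(* Subadditivity is available at positive indices only, so the remainder is kept positive: below,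
   [n.+1] is split with a remainder [r.+1] between 1 and [m]. *)
have uq m r q : (0 < m)%N -> (0 < r)%N ->
    (u (q * m + r)%N <= q%:R * u m + u r)%R.
  move=> m0 r0; elim: q => [|q ih]; first by rewrite mul0n add0n mul0r add0r.
  rewrite mulSn -addnA -natr1 mulrDl mul1r.
  by rewrite (le_trans (usub _ _ m0 _)) ?addn_gt0 ?r0 ?orbT//; lra.
apply/cvgrPdist_le => e e0.
have e20 : (0 < e / 2)%R by rewrite divr_gt0.
have [_ [m m0 <-] mL] := inf_adherent e20 Sinf.
(* A bound, independent of [n], for the error due to the remainder: the value at [r.+1], plus the
   [r.+1] missing multiples of the slope [u m / m]. *)
pose B := (\sum_(r < m) (`|u r.+1| + r.+1%:R * `|u m / m%:R|))%R.
have B0 : (0 <= B)%R by apply: sumr_ge0 => r _; rewrite addr_ge0// mulr_ge0.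
have uB n : (0 < n)%N -> (u n / n%:R <= u m / m%:R + B / n%:R)%R.
  case: n => // n _; set q := (n %/ m)%N; set r := (n %% m)%N.
  have nE : n.+1 = (q * m + r.+1)%N by rewrite addnS -divn_eq.
  have rm : (r < m)%N by rewrite ltn_mod.
  have rB : (`|u r.+1| + r.+1%:R * `|u m / m%:R| <= B)%R.
    rewrite /B (bigD1 (Ordinal rm))//= lerDl; apply: sumr_ge0 => i _.
    by rewrite addr_ge0// mulr_ge0.
  rewrite ler_pdivrMr ?ltr0n// mulrDl divfK ?pnatr_eq0//.
  rewrite [X in u X]nE (le_trans (uq _ _ _ m0 _))//.
  have m0' : (m%:R != 0 :> R)%R by rewrite pnatr_eq0 -lt0n.
  have -> : (q%:R * u m = u m / m%:R * n.+1%:R - u m / m%:R * r.+1%:R)%R.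
    by rewrite -mulrBr nE natrD addrK natrM mulrCA divfK.
  have := ler_norm (u r.+1); have := ler_norm (- (u m / m%:R))%R.
  rewrite normrN => h1 h2.
  have h3 : (r.+1%:R * - (u m / m%:R) <= r.+1%:R * `|u m / m%:R|)%R.
    by rewrite ler_wpM2l.
  lra.
near=> n.
have n0 : (0 < n)%N by near: n; exact: nbhs_infty_gt.
rewrite distrC ger0_norm ?subr_ge0 ?LS//.
have : (B / n%:R <= e / 2)%R.
  rewrite ler_pdivrMr ?ltr0n// mulrC -ler_pdivrMr//.
  by near: n; exact: nbhs_infty_ger.
have := uB _ n0; rewrite -/L in mL; lra.
Unshelve. all: by end_near. Qed.

Section words.
Context {I : finType}.

(** Compactness of the word space by König's argument: a word is good if all its extensions of some
    fixed length have a prefix in [C]. If every child of a word is good then so is the word, as the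
    alphabet is finite. A bad empty word would thus start an infinite path of bad words, which the
    covering forbids. *)
Lemma koenig_cylinder (C : set (seq I)) :
  (forall w, exists2 i, C i & cylinder i w) ->
  exists L, forall u : seq I, size u = L ->
    exists2 l, (l <= L)%N & C (take l u).
Proof.
move=> Ccov.
pose good u := exists L, forall v : seq I, size v = L ->
  exists2 l, (l <= size u + L)%N & C (take l (u ++ v)).
suff [L hL] : good [::] by exists L => u /hL.
apply: contrapT => bad0.
have bad_rcons u : ~ good u -> exists a, ~ good (rcons u a).
  move=> badu; apply: contrapT => /forallNP gooda; apply: badu.
  have [L hL] : {L : I -> nat & forall a (v : seq I), size v = L a ->
      exists2 l, (l <= size (rcons u a) + L a)%N & C (take l (rcons u a ++ v))}.
    apply: (@choice _ _ (fun a L => forall v : seq I, size v = L ->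
      exists2 l, (l <= size (rcons u a) + L)%N & C (take l (rcons u a ++ v)))).
    by move=> a; have /contrapT := gooda a.
  exists (\max_a L a).+1 => -[//|a v] [sv].
  have Lv : (L a <= size v)%N by rewrite sv; exact: leq_bigmax.
  have [|l] := hL a (take (L a) v); first exact: size_takel.
  rewrite size_rcons => lL Cl; exists l.
    by rewrite (leq_trans lL)// addSn addnS ltnS leq_add2l -sv.
  suff -> : take l (u ++ a :: v) = take l (u ++ a :: take (L a) v).
    by move: Cl; rewrite cat_rcons.
  rewrite -[in LHS](cat_take_drop (L a) v) -cat_cons catA takel_cat//.
  by rewrite size_cat/= addnS size_takel// -addSn.
have [a0 _] := bad_rcons _ bad0.
have [nxt nxtP] : {nxt : seq I -> I & forall u, ~ good u ->
    ~ good (rcons u (nxt u))}.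
  apply: (@choice _ _ (fun u a => ~ good u -> ~ good (rcons u a))) => u.
  have [|/bad_rcons[a ?]] := pselect (good u); first by exists a0.
  by exists a.
pose pref n := iter n (fun u => rcons u (nxt u)) [::].
pose w n := nxt (pref n).
have prefE n : prefix_word w n = pref n.
  by elim: n => // n ih; rewrite /prefix_word mkseqS -/(prefix_word w n) ih.
have badpref n : ~ good (pref n) by elim: n => // n; exact: nxtP.
(* The prefix of [w] lying in [C] is good with extension length 0. *)
have [i Ci iw] := Ccov w; apply: (badpref (size i)); exists 0%N => v.
move=> /size0nil ->; exists (size i).
  by rewrite -prefE size_mkseq addn0.
by rewrite cats0 -prefE iw take_size.
Qed.

Lemma sum_tuple_cat (V : nmodType) (l m : nat) (f : seq I -> V) :
  (\sum_(w : (l + m).-tuple I) f w =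
   \sum_(u : l.-tuple I) \sum_(v : m.-tuple I) f (u ++ v))%R.
Proof.
pose h (p : l.-tuple I * m.-tuple I) := cat_tuple p.1 p.2.
have hinj : injective h.
  move=> [u v] [u' v'] /(congr1 val)/= /eqP.
  rewrite eqseq_cat ?size_tuple// => /andP[/eqP uu /eqP vv].
  by congr (_, _); exact: val_inj.
have hbij : bijective h.
  by apply: inj_card_bij => //; rewrite card_prod !card_tuple expnD.
by rewrite (reindex h) ?pair_bigA//=; exact: onW_bij.
Qed.

Lemma sum_tuple_prefix (V : nmodType) (c : seq I) (m : nat) (f : seq I -> V) :
  (\sum_(w : (size c + m).-tuple I | take (size c) w == c)
     f (drop (size c) w) = \sum_(v : m.-tuple I) f v)%R.
Proof.
rewrite big_mkcond/= (sum_tuple_cat _ _ (fun w =>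
  if take (size c) w == c then f (drop (size c) w) else 0%R)).
rewrite (bigD1 (in_tuple c))//= [X in (_ + X)%R]big1 ?addr0; last first.
  move=> u uc; apply: big1 => v _.
  rewrite take_cat size_tuple ltnn subnn take0 cats0 ifF//.
  by apply: contraNF uc => /eqP uc; apply/eqP/val_inj.
by apply: eq_bigr => v _; rewrite take_size_cat// eqxx drop_size_cat.
Qed.

Lemma esum_ge_seq (R : realType) (T : choiceType) (C : set T) (f : T -> \bar R)
    (r : seq T) : uniq r -> (forall i, i \in r -> C i) ->
  \sum_(i <- r) f i <= \esum_(i in C) f i.
Proof.
move=> ur rC; apply: esum_ge; exists [set` r]; last by rewrite fsbig_seq.
by split=> //; exact: finite_seq.
Qed.

(* Splitting off the prefix in [C] bounds the sum over words of length [n] by [q]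
   times the largest of the [L] preceding ones, where [q] is the sum over the
   cover; if [q < 1] the sums decay to 0. *)
Lemma cover_sum_ge1 (R : realType) (f : seq I -> R) (K c : R)
    (C : set (seq I)) :
  (0 < c)%R -> (0 <= K)%R -> (forall u, 0 <= f u)%R ->
  (forall u v, finite_words u -> finite_words v ->
    f (u ++ v) <= K * f u * f v)%R ->
  (forall n, (0 < n)%N -> c <= \sum_(w : n.-tuple I) f w)%R ->
  C `<=` finite_words -> (forall w, exists2 i, C i & cylinder i w) ->
  exists r : seq (seq I), [/\ uniq r, forall i, i \in r -> C i
    & (1 <= \sum_(i <- r) K * f i)%R].
Proof.
move=> c0 K0 f0 fM Sc CI Ccov.
pose S n := (\sum_(w : n.-tuple I) f w)%R.
have [L CL] := koenig_cylinder Ccov.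
(* The members of [C] of length at most [L]; by the choice of [L] they already cover. *)
pose r := [seq val u | u in [pred u : L.-bseq I | `[< C (val u) >]]].
have ur : uniq r by rewrite map_inj_uniq ?enum_uniq//; exact: val_inj.
have rP i : i \in r -> C i /\ (size i <= L)%N.
  move=> /mapP[u]; rewrite mem_enum => /asboolP Cu ->.
  by split=> //; exact: size_bseq.
have rC i : C i -> (size i <= L)%N -> i \in r.
  move=> Ci iL; apply/mapP; exists (Bseq iL) => //.
  by rewrite mem_enum; exact/asboolP.
exists r; split=> //; first by move=> i /rP[].
set q := (\sum_(i <- r) _)%R.
rewrite leNgt; apply/negP => q1.
have q0 : (0 <= q)%R by apply: sumr_ge0 => i _; exact: mulr_ge0.
have S0 n : (0 <= S n)%R by apply: sumr_ge0.
(* Each word of length [n] has a prefix in [r]. As [n] exceeds [L], the remaining suffix is nonempty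
   and submultiplicativity applies; words with several such prefixes are merely overcounted. *)
have Srec n : (L < n)%N -> (S n <= \sum_(i <- r) K * f i * S (n - size i)%N)%R.
  move=> Ln.
  have -> : (\sum_(i <- r) K * f i * S (n - size i)%N =
     \sum_(i <- r) \sum_(w : n.-tuple I | take (size i) w == i)
       K * f i * f (drop (size i) w))%R.
    rewrite !big_seq; apply: eq_bigr => i /rP[_ iL].
    rewrite -mulr_sumr; congr (_ * _)%R.
    have /subnKC nE : (size i <= n)%N by rewrite (leq_trans iL)// ltnW.
    by move: (n - size i)%N nE => m <-; rewrite sum_tuple_prefix.
  under eq_bigr do rewrite big_mkcond/=.
  rewrite exchange_big/=; apply: ler_sum => w _.
  have [|l lL Cl] := CL (take L w).
    by rewrite size_takel// size_tuple ltnW.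
  move: Cl; rewrite take_takel// => Cl.
  have lw : (l <= size w)%N by rewrite size_tuple (leq_trans lL)// ltnW.
  have lr : take l w \in r by apply: rC => //; rewrite size_takel.
  rewrite (bigD1_seq _ lr ur)/= size_takel// eqxx.
  rewrite -[X in (f X <= _)%R](cat_take_drop l w).
  rewrite (le_trans (fM _ _ _ _))//; first exact: CI.
  - by rewrite /finite_words/= size_drop subn_gt0 size_tuple (leq_ltn_trans lL).
  - rewrite lerDl; apply: sumr_ge0 => i _; case: ifP => // _.
    by rewrite !mulr_ge0.
pose B := (\sum_(m < L.+1) S m)%R.
have B0 : (0 <= B)%R by apply: sumr_ge0.
have step b n k : (L < n)%N -> (0 <= b)%R ->
    (forall m, (m < n)%N -> (k < m + L)%N -> (0 < m)%N -> S m <= b)%R ->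
    (k < n)%N -> (S n <= q * b)%R.
  move=> Ln b0 Sb kn; apply: (le_trans (Srec _ Ln)); rewrite /q mulr_suml.
  rewrite !big_seq; apply: ler_sum => i /rP[/CI i0 iL].
  apply: ler_wpM2l; first exact: mulr_ge0.
  apply: Sb.
  - by rewrite ltn_subrL (leq_trans _ Ln)// i0.
  - by move: iL; move: (size i) => s sL; lia.
  - by rewrite subn_gt0 (leq_ltn_trans iL).
(* Each block of [L] lengths gains a factor [q]. For [k = 0] the bound [B] is propagated by strong
   induction: it dominates the sums up to length [L], and [q * B <= B] afterwards. *)
have decay k n : (0 < n)%N -> (k * L < n)%N -> (S n <= q ^+ k * B)%R.
  elim: k n => [|k ih] n n0 kn.
    rewrite expr0 mul1r; have [m mn] := ubnP n.
    elim: m n n0 kn mn => // m ihm n n0 _ nm.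
    have [nL|Ln] := leqP n L.
      rewrite /B (bigD1 (Ordinal (nL : n < L.+1)%N))//= lerDl.
      exact: sumr_ge0.
    rewrite (le_trans (step B n 0%N Ln B0 _ n0))//; last by rewrite ler_piMl// ltW.
    by move=> p pn _ p0; apply: ihm => //; rewrite (leq_trans pn).
  rewrite exprS -mulrA (step _ n (k.+1 * L)%N)//.
  - by rewrite (leq_ltn_trans _ kn)// mulSn leq_addr.
  - by rewrite mulr_ge0 ?exprn_ge0.
  - by move=> m _ km m0; apply: ih => //; move: km; rewrite mulSn addnC ltn_add2r.
have : (q ^+ k * B)%R @[k --> \oo] --> (0 * B)%R.
  by apply: cvgMl; apply: cvg_expr; rewrite ger0_norm.
rewrite mul0r => /cvgrPdist_lt/(_ _ c0)[k _ /(_ k (leqnn k))] /=.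
rewrite sub0r normrN ger0_norm ?mulr_ge0 ?exprn_ge0// ltNge.
by rewrite (le_trans (Sc (k * L).+1 isT))// decay.
Qed.

End words.

(** * Diameters and Hausdorff measures *)

Section diameter.
Context {R : realType} {M : metricType R}.
Implicit Types A B : set M.

Lemma diam_ge0 A : 0 <= diam A.
Proof. by rewrite /diam le_max lexx. Qed.

Lemma diam_le A (c : \bar R) : 0 <= c ->
  (forall x y, A x -> A y -> (mdist x y)%:E <= c) -> diam A <= c.
Proof.
move=> c0 Ac; rewrite /diam ge_max c0/=; apply: ge_ereal_sup.
by move=> _ [[x y] [/= Ax Ay] <-]; exact: Ac.
Qed.

Lemma mdist_le_diam A x y : A x -> A y -> (mdist x y)%:E <= diam A.
Proof.
move=> Ax Ay; rewrite /diam le_max; apply/orP; right.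
by apply: ereal_sup_ubound; exists (x, y).
Qed.

Lemma le_diam A B : A `<=` B -> diam A <= diam B.
Proof.
move=> AB; apply: diam_le => [|x y /AB Bx /AB By]; first exact: diam_ge0.
exact: mdist_le_diam.
Qed.

Lemma diam_set0 : diam (@set0 M) = 0.
Proof. by apply/eqP; rewrite eq_le diam_ge0 andbT; exact: diam_le. Qed.

Lemma diam_gt0_nonempty A : 0 < diam A -> A !=set0.
Proof.
by move=> A0; apply/set0P; apply: contraTneq A0 => ->; rewrite diam_set0 ltxx.
Qed.

Lemma compact_diam_lty A : compact A -> diam A < +oo.
Proof.
have [->|/set0P[x0 Ax0]] := eqVneq A set0; first by rewrite diam_set0 ltry.
move=> cA.
(* The distance to a base point is continuous, hence bounded on [A]; the triangle inequality then
   bounds the diameter. *)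
have cd : continuous (mdist x0 : M -> R).
  move=> y; apply/cvgrPdist_lt => e e0; near=> z.
  have : ball y e z by near: z; exact: nbhsx_ballx.
  rewrite ballEmdist/=; have := metric_triangle x0 y z.
  have := metric_triangle x0 z y; rewrite (metric_sym z y) ltr_norml => ? ? ?.
  by apply/andP; split; lra.
have /compact_bounded[N [_ /(_ (N + 1)%R)]] : compact (mdist x0 @` A : set R^o).
  by apply: continuous_compact => //; exact: continuous_subspaceT.
rewrite ltrDl ltr01 => /(_ isT) NA.
have Ax0N y : A y -> (mdist x0 y <= N + 1)%R.
  by move=> Ay; apply: le_trans (ler_norm _) _; apply: NA; exists y.
apply: (@le_lt_trans _ _ ((N + 1) + (N + 1))%:E); last exact: ltry.
apply: diam_le => [|x y Ax Ay].
  by rewrite lee_fin addr_ge0// (le_trans (mdist_ge0 _ _) (Ax0N _ Ax0)).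
rewrite lee_fin (le_trans (metric_triangle x x0 y))// metric_sym.
by rewrite lerD// Ax0N.
Unshelve. all: by end_near. Qed.

End diameter.

(** Cardinality bounds are passed on as bounds on duplicate-free lists, which needs no separate
    treatment of infinite sets. *)
Lemma counting_le_size (R : realType) (T : choiceType) (A : set T) (n : nat)
    (s : seq T) : (counting A : \bar R) <= n%:R%:E ->
  uniq s -> (forall i, i \in s -> A i) -> (size s <= n)%N.
Proof.
rewrite /counting; case: ifPn => [/asboolP fA|_]; last by rewrite leye_eq.
rewrite lee_fin ler_nat => An us sA; apply: leq_trans An.
apply: uniq_leq_size => // i /sA Ai.
by rewrite in_fset_set// inE.
Qed.

Lemma esum_le_size (R : realType) (T : choiceType) (A : set T) (n : nat)
    (f : T -> \bar R) (c : R) : (0 <= c)%R ->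
  (forall s : seq T, uniq s -> (forall i, i \in s -> A i) -> (size s <= n)%N) ->
  (forall i, A i -> f i <= c%:E) ->
  \esum_(i in A) f i <= (n%:R * c)%:E.
Proof.
move=> c0 An fc; apply: ge_ereal_sup => _ [F [/finite_seqP[s0 Fs0] FA] <-].
have {s0 Fs0} [s us Fs] : exists2 s, uniq s & F = [set` s].
  exists (undup s0); first exact: undup_uniq.
  by rewrite Fs0; apply/seteqP; split=> i /=; rewrite mem_undup.
have sA i : i \in s -> A i by move=> si; apply: FA; rewrite Fs.
rewrite Fs -fsbig_seq//.
apply: (@le_trans _ _ (\sum_(i <- s) c%:E)).
  by rewrite !big_seq; apply: lee_sum => i /sA; exact: fc.
rewrite sumEFin lee_fin big_const_seq count_predT iter_addr addr0.
by rewrite -[leLHS]mulr_natl ler_wpM2r// ler_nat An.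
Qed.

(** An open ball centred in a set of diameter [a] contains the set only if its radius may exceed
    [a]; this supplies such a radius at an arbitrarily small cost in the [t]-th power. *)
Lemma powR_approx (R : realType) (a t eta delta : R) :
  (0 <= a)%R -> (0 < t)%R -> (0 < eta)%R -> (a < delta)%R ->
  exists r, [/\ a < r, r < delta & r `^ t <= a `^ t + eta]%R.
Proof.
move=> a0 t0 eta0 ad; pose b := ((a `^ t + eta) `^ t^-1)%R.
have ab : (a < b)%R.
  rewrite -[ltLHS](@powRr1 _ a)// -(divff (lt0r_neq0 t0)) powRrM.
  by apply: gt0_ltr_powR; rewrite ?invr_gt0// ?nnegrE ?addr_ge0 ?powR_ge0 ?ltW//
    ltrDl.
exists (Num.min b ((a + delta) / 2))%R; split.
- by rewrite lt_min ab/=; lra.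
- by rewrite gt_min; apply/orP; right; lra.
- have -> : (a `^ t + eta = b `^ t)%R.
    rewrite /b -powRrM mulVf ?lt0r_neq0// powRr1//.
    by rewrite addr_ge0 ?powR_ge0// ltW.
  apply: ge0_ler_powR; rewrite ?nnegrE ?powR_ge0 ?(ltW t0) ?ge_min ?lexx//.
  by rewrite le_min powR_ge0/=; lra.
Qed.

Section hausdorff.
Context {R : realType} {M : metricType R}.
Variables (t : R) (E : set M).

Lemma hausdorff_content_ge0 delta : 0 <= hausdorff_content t delta E.
Proof.
apply: le_ereal_inf_tmp => _ [A _ <-]; apply: nneseries_ge0 => k _ _.
exact: poweR_ge0.
Qed.

Hypothesis t0 : t != 0%R.

Lemma hausdorff_measureE :
  hausdorff_measure t E = ereal_sup [set hausdorff_content t delta E |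
    delta in [set delta | (0 < delta)%R]].
Proof.
rewrite /hausdorff_measure (negPf t0); apply/cvg_lim => //.
have -> : [set delta : R | (0 < delta)%R] =
    [set` Interval (BRight 0%R) (BInfty R false)].
  by apply/seteqP; split=> x /=; rewrite in_itv/= andbT.
apply: nonincreasing_at_right_cvge => // a b _ _ ab.
apply: ereal_inf_le_tmp => _ [A [EA Aa] <-]; exists A => //; split=> // k.
by rewrite (lt_le_trans (Aa k))// lee_fin.
Qed.

Lemma hausdorff_content_le_measure delta : (0 < delta)%R ->
  hausdorff_content t delta E <= hausdorff_measure t E.
Proof.
by move=> d0; rewrite hausdorff_measureE; apply: ereal_sup_ubound; exists delta.
Qed.

Lemma hausdorff_measure_le c :
  (forall delta, (0 < delta)%R -> hausdorff_content t delta E <= c) ->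
  hausdorff_measure t E <= c.
Proof.
move=> Ec; rewrite hausdorff_measureE; apply: ge_ereal_sup => _ [delta d0 <-].
exact: Ec.
Qed.

End hausdorff.

(** * Weakly controlled Moran constructions *)

Section moran_construction.
Context {R : realType} {M : metricType R} {I : finType}.
Variables (X : seq I -> set M) (D : R).
Hypothesis D1 : (1 <= D)%R.
Hypothesis Xcompact : forall i, finite_words i -> compact (X i).
Hypothesis Xdiam : forall i, finite_words i -> 0 < diam (X i).
Hypothesis W1 : forall i, (1 < size i)%N -> X i `<=` X (parent i).
Hypothesis W2 : exists n, (0 < n)%N /\
  \big[maxe/-oo]_(i : n.-tuple I) diam (X i) < (D^-1)%:E.
Hypothesis W3 : forall i j, finite_words i -> finite_words j ->
  diam (X (i ++ j)) <= D%:E * diam (X i) * diam (X j).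
Hypothesis W4 : forall i, (1 < size i)%N ->
  (D^-1)%:E * diam (X (parent i)) <= diam (X i).
Implicit Types (i u v : seq I) (w : nat -> I).

(** * Diameters along words and existence of the projection *)

Let d u : R := fine (diam (X u)).

Let D0 : (0 < D)%R. Proof. exact: lt_le_trans D1. Qed.

Lemma diam_word u : finite_words u -> diam (X u) = (d u)%:E.
Proof.
by move=> /Xcompact/compact_diam_lty Xu; rewrite fineK// ge0_fin_numE// diam_ge0.
Qed.

Lemma fine_diam_gt0 u : finite_words u -> (0 < d u)%R.
Proof. by move=> u0; rewrite -lte_fin -diam_word// Xdiam. Qed.

Lemma fine_diam_cat u v : finite_words u -> finite_words v ->
  (d (u ++ v) <= D * d u * d v)%R.
Proof.
move=> u0 v0; rewrite -lee_fin !EFinM -!diam_word ?W3//.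
by rewrite /finite_words/= size_cat addn_gt0 u0.
Qed.

Lemma sub_take_word u l : (0 < l)%N -> X u `<=` X (take l u).
Proof.
move=> l0; have [n] := ubnP (size u); elim: n u => // n ih u un.
have [ul|lu] := leqP (size u) l; first by rewrite take_oversize.
have u1 : (1 < size u)%N by rewrite (leq_ltn_trans l0).
have su : size (parent u) = (size u).-1 by rewrite size_takel// leq_pred.
apply: (subset_trans (W1 u1)).
rewrite (_ : take l u = take l (parent u)); first by apply: ih; rewrite su; lia.
by rewrite /parent take_takel//; lia.
Qed.

Lemma fine_diam_take u l : (0 < l)%N -> finite_words u ->
  (d u <= d (take l u))%R.
Proof.
move=> l0 u0; rewrite -lee_fin -!diam_word//; first exact/le_diam/sub_take_word.
by rewrite /finite_words/= size_take_min leq_min l0.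
Qed.

(** By (W3) the quantity [D * d u] is submultiplicative, and by (W2) its maximum [rho] over words of
    length [m] is below 1. It therefore decays geometrically along multiples of [m], and (W1) passes
    the bound to all longer words. *)
Lemma fine_diam_small (e : R) : (0 < e)%R ->
  exists N, (0 < N)%N /\ forall u, (N <= size u)%N -> (d u < e)%R.
Proof.
move=> e0; have [m [m0 mD]] := W2.
pose rho := (\big[Num.max/0]_(u : m.-tuple I) (D * d u))%R.
have rho0 : (0 <= rho)%R by exact: bigmax_ge_id.
have rho1 : (rho < 1)%R.
  apply: bigmax_lt => // u _.
  rewrite -ltr_pdivlMl// mulr1 -lte_fin -diam_word; last first.
    by rewrite /finite_words/= size_tuple.
  by apply: le_lt_trans mD; exact: le_bigmax.
have rhoX k u : size u = (k.+1 * m)%N -> (D * d u <= rho ^+ k.+1)%R.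
  elim: k u => [|k ih] u uk.
    rewrite mul1n in uk.
    by rewrite expr1 /rho; apply: (le_trans _ (le_bigmax _ _ (Tuple (introT eqP uk)))).
  have mu : (m <= size u)%N by rewrite uk mulSn leq_addr.
  have tm : size (take m u) = m by rewrite size_takel.
  have sdu : size (drop m u) = (k.+1 * m)%N by rewrite size_drop uk mulSn addKn.
  rewrite -[X in d X](cat_take_drop m u).
  apply: (@le_trans _ _ (D * (D * d (take m u) * d (drop m u)))%R).
    apply: ler_wpM2l; first exact: ltW.
    apply: fine_diam_cat; first by rewrite /finite_words/= tm.
    by rewrite /finite_words/= sdu muln_gt0.
  have -> : (D * (D * d (take m u) * d (drop m u)) =
    (D * d (take m u)) * (D * d (drop m u)))%R by lra.
  rewrite exprS; apply: ler_pM.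
  - by rewrite mulr_ge0 ?(ltW D0)// fine_ge0// diam_ge0.
  - by rewrite mulr_ge0 ?(ltW D0)// fine_ge0// diam_ge0.
  - rewrite /rho.
    by apply: (le_trans _ (le_bigmax _ _ (Tuple (introT eqP tm)))).
  - exact: ih.
have : (rho ^+ k)%R @[k --> \oo] --> (0 : R)%R.
  by apply: cvg_expr; rewrite ger0_norm.
move=> /cvgrPdist_lt/(_ _ e0)[k _ /(_ k.+1 (leqnSn k))] /=.
rewrite sub0r normrN ger0_norm ?exprn_ge0// => rke.
have km0 : (0 < k.+1 * m)%N by rewrite muln_gt0.
exists (k.+1 * m)%N; split=> // u ku; apply: le_lt_trans rke.
have u0 : finite_words u by rewrite /finite_words/= (leq_trans km0).
rewrite (le_trans (fine_diam_take km0 u0))//.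
rewrite (le_trans _ (rhoX k _ (size_takel ku)))// ler_peMl//.
by rewrite fine_ge0// diam_ge0.
Qed.

(** There are finitely many words of length at most [n]. Conversely, a word of diameter below [e]
    must be longer than [n], which is how the bound is used. *)
Lemma fine_diam_lbound n : exists e : R, (0 < e)%R /\
  forall u, finite_words u -> (size u <= n)%N -> (e <= d u)%R.
Proof.
exists (\big[Num.min/1]_(u : n.-bseq I | (0 < size u)%N) d u)%R; split.
  by apply: lt_bigmin => // u; exact: fine_diam_gt0.
move=> u u0 un.
exact: (@bigmin_le_cond _ _ _ _ (Bseq un) _ (fun c : n.-bseq I => d c)).
Qed.

Lemma exists_projects_to w : exists x, projects_to X w x.
Proof.
pose Y n := X (prefix_word w n.+1).
have Yw n : finite_words (prefix_word w n.+1).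
  by [].
have YS m n : (m <= n)%N -> Y n `<=` Y m.
  by move=> mn; rewrite /Y -(@prefix_word_take _ w m.+1 n.+1)//; exact: sub_take_word.
have [y yY] : {y : nat -> M & forall n, Y n (y n)}.
  apply: (@choice _ _ (fun n y => Y n y)) => n.
  by have [y] := diam_gt0_nonempty (Xdiam (Yw n)); exists y.
have yF n : \forall k \near \oo, Y n (y k).
  by exists n => // k /= nk; exact: (YS _ _ nk _ (yY k)).
(* Every [Y n] is closed and contains a tail of the sequence [y], so a cluster point lies in all of
   them; uniqueness follows since the diameters tend to 0. *)
have [p [_ clp]] := Xcompact (Yw 0%N) (fmap_proper_filter y _) (yF 0%N).
have pY n : Y n p.
  have Ycl : closed (Y n).
    by apply: compact_closed; [exact: metric_hausdorff|exact: Xcompact].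
  by apply: Ycl => B; apply: clp; exact: yF.
exists p; apply/seteqP; split=> [q qY|_ -> [|n] //= _]; last exact: pY.
apply/mdist_positivity/eqP; rewrite eq_le mdist_ge0 andbT.
apply/ler_addgt0Pl => e e0; rewrite addr0.
have [N [N0 /(_ (prefix_word w N.+1))]] := fine_diam_small e0.
rewrite /prefix_word size_mkseq leqnSn => /(_ isT)/ltW; apply: le_trans.
rewrite -lee_fin -diam_word//; apply: mdist_le_diam; last exact: pY.
exact: (qY N.+1).
Qed.

(** * Sums over words of fixed length and pressure *)

Variable t : R.
Hypothesis t0 : (0 <= t)%R.

Let f u : R := (d u `^ t)%R.
Let S n : R := (\sum_(w : n.-tuple I) f w)%R.
Let K : R := (D `^ t)%R.

Let K0 : (0 < K)%R. Proof. exact: powR_gt0. Qed.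

Lemma powR_diam_cat u v : finite_words u -> finite_words v ->
  (f (u ++ v) <= K * f u * f v)%R.
Proof.
move=> u0 v0; rewrite /f /K -!powRM ?mulr_ge0 ?(ltW D0) ?(ltW (fine_diam_gt0 _))//.
apply: ge0_ler_powR; rewrite ?nnegrE//.
- by rewrite fine_ge0// diam_ge0.
- by rewrite !mulr_ge0 ?(ltW D0) ?(ltW (fine_diam_gt0 _)).
- exact: fine_diam_cat.
Qed.

Lemma poweR_diam_word u : finite_words u -> diam (X u) `^ t = (f u)%:E.
Proof. by move=> u0; rewrite diam_word// poweR_EFin. Qed.

Lemma sum_diam_gt0 n : (0 < #|I|)%N -> (0 < n)%N -> (0 < S n)%R.
Proof.
move=> /card_gt0P[a _] n0; rewrite /S (bigD1 [tuple of nseq n a])//=.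
rewrite ltr_pwDl//; last by apply: sumr_ge0 => w _; exact: powR_ge0.
by apply/powR_gt0/fine_diam_gt0; rewrite /finite_words/= size_nseq.
Qed.

(* (W4) along a constant word bounds the sums below exponentially, so that the
   limit defining the pressure exists. *)
Lemma pressure_ge0_sum : (0 < #|I|)%N -> (0 <= pressure X t)%R ->
  forall n, (0 < n)%N -> (K^-1 <= S n)%R.
Proof.
move=> I0 P0.
(* The factor [K] absorbs the constant of (W3), so that [u] is truly subadditive; it disappears in
   the limit because [ln K / n] tends to 0. *)
pose u n := ln (K * S n)%R.
have KS0 n : (0 < n)%N -> (0 < K * S n)%R.
  by move=> n0; rewrite mulr_gt0// sum_diam_gt0.
have usub m n : (0 < m)%N -> (0 < n)%N -> (u (m + n)%N <= u m + u n)%R.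
  move=> m0 n0; rewrite /u -lnM ?posrE ?KS0// ler_ln ?posrE ?KS0//; last 2 first.
  - by rewrite addn_gt0 m0.
  - by rewrite mulr_gt0 ?KS0.
  rewrite -!mulrA; apply: ler_wpM2l; first exact: ltW.
  rewrite /S sum_tuple_cat mulr_suml; apply: ler_sum => v _.
  rewrite mulr_sumr mulr_sumr; apply: ler_sum => w _.
  rewrite (le_trans (powR_diam_cat _ _))//.
  - by rewrite /finite_words/= size_tuple.
  - by rewrite /finite_words/= size_tuple.
  - by rewrite mulrCA mulrA.
have [a _] := card_gt0P I0.
pose c := (- (t * (ln D + `|ln (d [:: a])|)))%R.
have ln_const n : (ln (d [:: a]) - n%:R * ln D <= ln (d (nseq n.+1 a)))%R.
  elim: n => [|n ih]; first by rewrite mul0r subr0.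
  have h m : finite_words (nseq m.+1 a) by rewrite /finite_words/= size_nseq.
  have := W4 (i := nseq n.+2 a); rewrite size_nseq => /(_ isT).
  have -> : parent (nseq n.+2 a) = nseq n.+1 a.
    by rewrite /parent size_nseq take_nseq.
  rewrite !diam_word// -EFinM lee_fin.
  rewrite -ler_ln ?posrE ?mulr_gt0 ?invr_gt0 ?fine_diam_gt0//.
  rewrite lnM ?posrE ?invr_gt0 ?fine_diam_gt0// lnV ?posrE//.
  by rewrite -natr1; lra.
have ulb n : (0 < n)%N -> (c * n%:R <= u n)%R.
  case: n => // n _.
  have lnD : (0 <= ln D)%R by exact: ln_ge0.
  have K1 : (1 <= K)%R.
    by rewrite /K -(powRr0 D) ler_powR.
  have fS : (f (nseq n.+1 a) <= S n.+1)%R.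
    rewrite /S (bigD1 [tuple of nseq n.+1 a])//= lerDl; apply: sumr_ge0 => w _.
    exact: powR_ge0.
  have dn0 : (0 < d (nseq n.+1 a))%R.
    by apply: fine_diam_gt0; rewrite /finite_words/= size_nseq.
  have f0 : (0 < f (nseq n.+1 a))%R by exact: powR_gt0.
  apply: (@le_trans _ _ (ln (f (nseq n.+1 a)))); last first.
    rewrite /u ler_ln ?posrE ?KS0// (le_trans fS)// ler_peMl// ltW//.
    exact: sum_diam_gt0.
  rewrite /f ln_powR /c mulNr -mulrA -mulrN ler_wpM2l//.
  apply: le_trans (ln_const n).
  have := ler_norm (- ln (d [:: a]))%R; rewrite normrN.
  rewrite -natr1; have := ler0n R n; have := normr_ge0 (ln (d [:: a])); nra.
have [uL Lu] := fekete usub ulb.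
set L := inf _ in uL Lu.
have PL : pressure X t = L.
  apply/cvg_lim => //.
  have : (u n / n%:R - ln K / n%:R)%R @[n --> \oo] --> (L - 0)%R.
    apply: cvgB => //; rewrite -(mulr0 (ln K)); apply: cvgMr.
    apply/gtr0_cvgV0; last exact: cvgr_idn.
    by exists 1%N => // n /= n1; rewrite ltr0n.
  rewrite subr0; apply: cvg_trans; apply: near_eq_cvg; near=> n.
  have n0 : (0 < n)%N by near: n; exact: nbhs_infty_gt.
  rewrite -mulrBl mulrC /u lnM ?posrE ?sum_diam_gt0// addrAC subrr add0r.
  congr (_ * ln _)%R; rewrite (eq_bigr (fun w : n.-tuple I => (f w)%:E)).
    by rewrite sumEFin.
  by move=> w _; rewrite poweR_diam_word// /finite_words/= size_tuple.
(* The Fekete limit is an infimum, so its nonnegativity bounds every [u n], not only large ones. *)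
move=> n n0; have : (0 <= u n)%R.
  by apply: le_trans (Lu _ n0); rewrite mulr_ge0// -PL.
rewrite -ln1 /u ler_ln ?posrE ?KS0// mulrC -ler_pdivrMr// div1r//.
Unshelve. all: by end_near. Qed.

Lemma Mtn_setT_ge n : (0 < #|I|)%N -> (0 <= pressure X t)%R ->
  (K^-1)%:E <= Mtn X t n [set: nat -> I].
Proof.
move=> I0 P0; apply: le_ereal_inf_tmp => _ [C [CI Ccov _] <-].
have iK0 : (0 < K^-1)%R by rewrite invr_gt0.
have [r [ur rC r1]] := cover_sum_ge1 iK0 (ltW K0) (fun u => powR_ge0 _ _)
  powR_diam_cat (pressure_ge0_sum I0 P0) CI (fun w => Ccov w Logic.I).
apply: le_trans (esum_ge_seq _ ur rC).
rewrite big_seq (eq_bigr (fun i => (f i)%:E)); last first.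
  by move=> i /rC/CI i0; rewrite poweR_diam_word.
rewrite -big_seq sumEFin lee_fin -[leLHS]mul1r ler_pdivrMr// mulrC mulr_sumr.
exact: r1.
Qed.

(** * Comparison of the net measure with Hausdorff measure *)

Lemma projects_to_prefix w x n : projects_to X w x -> (0 < n)%N ->
  X (prefix_word w n) x.
Proof. by move=> wx n0; have : [set x] x by []; rewrite -wx; apply. Qed.

Lemma hausdorff_measure_le_Mt : t != 0%R ->
  hausdorff_measure t (limit_set X) <= Mt X t [set: nat -> I].
Proof.
move=> tn0; apply: hausdorff_measure_le => // delta delta0.
have [N [N0 dN]] := fine_diam_small delta0.
apply: le_trans (Mtn_le_Mt X t N _).
apply: le_ereal_inf_tmp => _ [C [CI Ccov CN] <-].
(* With [pickle_inv] each word of [C] occurs at exactly one index. All other indices carry the empty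
   set, which contributes 0 as [t] is nonzero. *)
pose A k := if pickle_inv k is Some u then
  if u \in C then X u else set0 else set0.
apply: (@le_trans _ _ (\sum_(0 <= k <oo) diam (A k) `^ t)).
  apply: ereal_inf_lbound; exists A => //; split.
    move=> x [w wx]; have [u Cu uw] := Ccov w Logic.I.
    exists (pickle u) => //; rewrite /A pickleK_inv mem_set//.
    by rewrite -uw; apply: projects_to_prefix => //; exact: CI.
  move=> k; rewrite /A; case: pickle_inv => [u|]; last by rewrite diam_set0 lte_fin.
  case: ifPn => [/set_mem Cu|_]; last by rewrite diam_set0 lte_fin.
  by rewrite diam_word ?lte_fin; [exact/dN/CN|exact: CI].
rewrite nneseries_esumT; last by move=> k; exact: poweR_ge0.
rewrite -(_ : \esum_(k in pickle @` C) diam (A k) `^ t =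
  \esum_(k in [set: nat]) diam (A k) `^ t).
  rewrite esum_image; last by move=> u v _ _; exact: (pcan_inj pickleK).
  by apply: le_esum => u Cu; rewrite /A pickleK_inv mem_set.
rewrite esum_mkcond; apply: eq_esum => k _; case: ifPn => // /negP kC.
rewrite /A; have := pickle_invK (T := seq I) k.
case: pickle_inv => [u /= uk|_]; last by rewrite diam_set0 poweR0r.
case: ifPn => [/set_mem Cu|_]; last by rewrite diam_set0 poweR0r.
by exfalso; apply/kC/mem_set; exists u.
Qed.

(** The bound is stated through lists so that its failure is witnessed by finitely many words, which
    makes the complement open. *)
Definition tame (N k : nat) : set (nat -> I) :=
  [set w | forall x r, projects_to X w x -> (0 < r < k.+1%:R^-1)%R ->
    forall s : seq (seq I), uniq s -> (forall i, i \in s -> Zxr X x r i) ->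
    (size s <= N)%N].

Lemma nondecreasing_tame N : nondecreasing_seq (tame N).
Proof.
move=> k l kl; apply/subsetPset => w kw x r wx /andP[r0 rl]; apply: kw => //.
by rewrite r0 (lt_le_trans rl)// lef_pV2 ?posrE ?ltr0n// ler_nat ltnS.
Qed.

Lemma caratheodory_tame N k : (Mt X t).-caratheodory (tame N k).
Proof.
apply: caratheodory_cylinder_closed => w.
move=> /existsNP[x /existsNP[r /not_implyP[wx /not_implyP[rk]]]].
move=> /existsNP[s /not_implyP[us /not_implyP[sZ /negP]]].
rewrite -ltnNge => Ns.
have [y yP] : {y : seq I -> M & forall i, i \in s ->
    X i (y i) /\ ball x r (y i)}.
  apply: (@choice _ _ (fun i y => i \in s -> X i y /\ ball x r y)) => i.
  have [/sZ[_ [y xy]]|_] := boolP (i \in s); last by exists x.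
  by exists y => _; split; [exact: xy.1|exact: xy.2].
(* The least slack of the points [y i] inside the open ball. Moving the centre by less than [rho]
   keeps them all in the ball, so all words with a sufficiently long common prefix with [w] fail to
   be tame too. *)
pose rho := (\big[Num.min/r]_(i <- s) (r - mdist x (y i)))%R.
have rho0 : (0 < rho)%R.
  rewrite /rho big_seq; apply: lt_bigmin; first by have /andP[] := rk.
  by move=> i /yP[_]; rewrite ballEmdist/= subr_gt0.
have [m [m0 dm]] := fine_diam_small rho0.
exists (prefix_word w m); split; first by rewrite /cylinder/= /prefix_word size_mkseq.
move=> w' ww' tw'; have [x' wx'] := exists_projects_to w'.
suff : (size s <= N)%N by rewrite leqNgt Ns.
apply: (tw' x' r wx' rk) => // i si; split; first by have [] := sZ _ si.
have [Xiy _] := yP _ si; exists (y i); split=> //.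
rewrite ballEmdist/= (le_lt_trans (metric_triangle _ x _))//.
have : (mdist x' x < rho)%R.
  apply: le_lt_trans (dm (prefix_word w m) _); last by rewrite /prefix_word size_mkseq.
  rewrite -lee_fin -diam_word; last by rewrite /finite_words/= /prefix_word size_mkseq.
  apply: mdist_le_diam; last exact: projects_to_prefix.
  have := projects_to_prefix wx' m0.
  by move: ww'; rewrite /cylinder/= /prefix_word size_mkseq => ->.
have : (rho <= r - mdist x (y i))%R by exact: (@ge_bigmin_seq _ _ _ _ _ i).
lra.
Qed.

(* A ball around the projection of a tame word meets at most [N] of the sets of
   comparable diameter; their cylinders cover the preimage of the ball. *)
Lemma Mtn_tame_le_balls N k n : exists delta : R, (0 < delta)%R /\
  forall (J : set nat) (x : nat -> M) (r : nat -> R),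
  (forall j, J j -> exists2 w, tame N k w & projects_to X w (x j)) ->
  (forall j, J j -> 0 < r j < delta)%R ->
  (forall w p, tame N k w -> projects_to X w p ->
    exists2 j, J j & ball (x j) (r j) p) ->
  Mtn X t n (tame N k) <= \esum_(j in J) (N%:R * r j `^ t)%:E.
Proof.
(* Radii below [e] force the words of [Zr X r] to be longer than [n]. Using [n.+1] includes words of
   length 1 even for [n = 0], so that the first small prefix found below has a parent. *)
have [e [e0 eP]] := fine_diam_lbound n.+1.
exists (Num.min e k.+1%:R^-1)%R; split; first by rewrite lt_min e0 invr_gt0 ltr0n.
move=> J x r xJ rJ xcov.
have re j : J j -> (0 < r j < e)%R.
  by move=> /rJ; rewrite lt_min => /andP[-> /andP[->]].
have rk j : J j -> (0 < r j < k.+1%:R^-1)%R.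
  by move=> /rJ; rewrite lt_min => /andP[-> /andP[_ ->]].
have ZrP j i : J j -> Zr X (r j) i ->
    [/\ finite_words i, (d i <= r j)%R & (n < size i)%N].
  move=> /re/andP[_ rje] [i1 /andP[di _]].
  have i0 : finite_words i by exact: ltnW.
  have dir : (d i <= r j)%R by rewrite -lee_fin -diam_word.
  split=> //; rewrite ltnNge; apply/negP => ni.
  by have := eP _ i0 (leqW ni); rewrite leNgt (le_lt_trans dir).
apply: (@le_trans _ _
    (\esum_(i in \bigcup_(j in J) Zxr X (x j) (r j)) diam (X i) `^ t)).
  apply: Mtn_le_esum.
  - by move=> i [j Jj [/(ZrP _ _ Jj)[]]].
  - move=> w tw; have [p wp] := exists_projects_to w.
    have [j Jj pj] := xcov _ _ tw wp; have /andP[r0 rje] := re _ Jj.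
    have [m0 [m00 dm0]] := fine_diam_small r0.
    (* The shortest prefix of diameter at most [r j] belongs to [Zr X (r j)]: by minimality its
       parent is larger. *)
    have exm : exists m, (0 < m)%N && (d (prefix_word w m) <= r j)%R.
      by exists m0; rewrite m00 ltW// dm0// /prefix_word size_mkseq.
    case: (ex_minnP exm) => m /andP[m1 dm] mmin.
    have pw1 l : (0 < l)%N -> finite_words (prefix_word w l).
      by rewrite /finite_words/= /prefix_word size_mkseq.
    have m2 : (1 < m)%N.
      rewrite ltn_neqAle m1 andbT; apply/eqP => m1'; move: dm; rewrite -m1' leNgt.
      by rewrite (lt_le_trans rje)// eP//; exact: pw1.
    exists (prefix_word w m); last by rewrite /cylinder/= /prefix_word size_mkseq.
    exists j => //; split.
      split; first by rewrite /prefix_word size_mkseq.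
      have -> : parent (prefix_word w m) = prefix_word w m.-1.
        by rewrite /parent [size _]size_mkseq prefix_word_take// leq_pred.
      have m11 : (0 < m.-1)%N by rewrite -ltnS prednK.
      rewrite !diam_word ?lee_fin ?lte_fin ?dm/=; [|exact: pw1..].
      rewrite ltNge; apply/negP => dm'.
      have := mmin m.-1; rewrite m11 dm' => /(_ isT).
      by rewrite leqNgt prednK// leqnn.
    by exists p; split=> //; exact: projects_to_prefix.
  - by move=> i [j Jj [/(ZrP _ _ Jj)[_ _ /ltnW]]].
apply: (le_trans (esum_bigcup_le _ _ _)) => [i|]; first exact: poweR_ge0.
apply: le_esum => j Jj.
have [w tw wx] := xJ _ Jj.
apply: esum_le_size; first exact: powR_ge0.
  by move=> s; apply: (tw _ _ wx); exact: rk.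
move=> i [/(ZrP _ _ Jj)[i0 dr _] _].
rewrite poweR_diam_word// lee_fin; apply: ge0_ler_powR => //; rewrite nnegrE.
  exact/ltW/fine_diam_gt0.
by have /andP[/ltW] := re _ Jj.
Qed.

Lemma Mt_tame_le_hausdorff N k : (0 < #|I|)%N -> (0 < N)%N -> (0 < t)%R ->
  Mt X t (tame N k) <= N%:R%:E * hausdorff_measure t (limit_set X).
Proof.
move=> /card_gt0P[a _] N0 tgt0; apply: Mt_le => n.
have [x0 _] := exists_projects_to (fun=> a).
have [delta [delta0 hdelta]] := Mtn_tame_le_balls N k n.
have tn0 : t != 0%R by rewrite gt_eqF.
have N0' : (0 < N%:R :> R)%R by rewrite ltr0n.
apply: (@le_trans _ _ (N%:R%:E * hausdorff_content t delta (limit_set X))); last first.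
  by rewrite lee_pmul2l ?lte_fin//; exact: hausdorff_content_le_measure.
have [->|Hfin] := eqVneq (hausdorff_content t delta (limit_set X)) +oo.
  by rewrite gt0_muley ?leey// lte_fin.
have {}Hfin : hausdorff_content t delta (limit_set X) \is a fin_num.
  by rewrite ge0_fin_numE ?hausdorff_content_ge0// ltey.
apply/lee_addgt0Pr => e e0.
(* One [e'] pays for the near-optimal cover, another for enlarging diameters to radii; multiplied by
   [N] they add up to [e]. *)
pose e' := (e / N%:R / 2)%R.
have e'0 : (0 < e')%R by rewrite !divr_gt0.
have [_ [A [EA Ad] <-] /ltW Ae] := lb_ereal_inf_adherent e'0 Hfin.
(* Only the sets that contain the projection of a tame word are kept, since the balls must be
   centred at such points. *)
pose J := [set j | exists x, A j x /\ exists2 w, tame N k w & projects_to X w x].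
have [x xP] : {x : nat -> M & forall j, J j ->
    A j (x j) /\ exists2 w, tame N k w & projects_to X w (x j)}.
  apply: (@choice _ _ (fun j x => J j ->
    A j x /\ exists2 w, tame N k w & projects_to X w x)) => j.
  have [[x xj]|nJ] := pselect (J j); first by exists x.
  by exists x0 => /nJ.
have [r rP] : {r : nat -> R & forall j, [/\ diam (A j) < (r j)%:E,
    (r j < delta)%R &
    (r j `^ t)%:E <= diam (A j) `^ t + (e' / (2 ^ j.+1)%:R)%:E]}.
  apply: (@choice _ _ (fun j r => [/\ diam (A j) < r%:E, (r < delta)%R &
    (r `^ t)%:E <= diam (A j) `^ t + (e' / (2 ^ j.+1)%:R)%:E])) => j.
  have Afin : diam (A j) \is a fin_num.
    by rewrite ge0_fin_numE ?diam_ge0// (lt_trans (Ad j))// ltry.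
  have ej0 : (0 < e' / (2 ^ j.+1)%:R)%R by rewrite divr_gt0// ltr0n expn_gt0.
  have [||r [ar rd rt]] :=
    powR_approx (a := fine (diam (A j))) (delta := delta) _ tgt0 ej0.
  - by rewrite fine_ge0// diam_ge0.
  - by rewrite -lte_fin fineK.
  - exists r; split=> //; first by rewrite -(fineK Afin) lte_fin.
    by rewrite -(fineK Afin) poweR_EFin -EFinD lee_fin.
have r0 j : (0 <= r j)%R.
  have [Ar _ _] := rP j; rewrite -lee_fin; apply: ltW.
  by apply: le_lt_trans Ar; exact: diam_ge0.
apply: (le_trans (hdelta J x r _ _ _)).
- by move=> j /xP[].
- move=> j _; have [Ar -> _] := rP j; rewrite andbT -lte_fin.
  by apply: le_lt_trans Ar; exact: diam_ge0.
- move=> w p tw wp; have [|j _ Ajp] := EA p; first by exists w.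
  have Jj : J j by exists p; split=> //; exists w.
  exists j => //; rewrite ballEmdist/= -lte_fin; have [Ar _ _] := rP j.
  by apply: le_lt_trans Ar; apply: mdist_le_diam => //; have [] := xP _ Jj.
apply: (@le_trans _ _ (\esum_(j in [set: nat]) (N%:R * r j `^ t)%:E)).
  by apply: le_esum_set => // j _; rewrite lee_fin mulr_ge0// powR_ge0.
rewrite -nneseries_esumT; last by move=> j; rewrite lee_fin mulr_ge0// powR_ge0.
under eq_eseriesr do rewrite EFinM.
rewrite nneseriesZl; last by move=> j _; rewrite lee_fin powR_ge0.
have -> : e%:E = N%:R%:E * (e' + e')%:E.
  by rewrite -EFinM -splitr mulrC divfK// gt_eqF.
rewrite -ge0_muleDr ?hausdorff_content_ge0//; last by rewrite lee_fin addr_ge0 ?ltW.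
rewrite lee_pmul2l ?lte_fin//.
apply: (@le_trans _ _ (\sum_(0 <= j <oo)
    (diam (A j) `^ t + (e' / (2 ^ j.+1)%:R)%:E))).
  apply: lee_nneseries => j _; first by rewrite lee_fin powR_ge0.
  by have [] := rP j.
apply: (le_trans (epsilon_trick _ _ (ltW e'0))).
  by move=> j; exact: poweR_ge0.
by rewrite EFinD addeA leeD2r.
Qed.

(** If the limit set is finite, one ball around each of its points suffices at every scale, and for
    [t = 0] each ball costs [N] whatever its radius. *)
Lemma Mt_tame_le_counting N k (s : seq M) : (0 < #|I|)%N -> t = 0%R ->
  (forall x, limit_set X x -> x \in s) ->
  Mt X t (tame N k) <= (\sum_(j < size s) N%:R)%:E.
Proof.
move=> /card_gt0P[a _] tE0 Es; apply: Mt_le => n.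
have [x0 _] := exists_projects_to (fun=> a).
have [delta [delta0 hdelta]] := Mtn_tame_le_balls N k n.
pose J := [set j | (j < size s)%N /\
  exists2 w, tame N k w & projects_to X w (nth x0 s j)].
apply: (le_trans (hdelta J (nth x0 s) (fun=> delta / 2)%R _ _ _)).
- by move=> j [].
- by move=> j _; apply/andP; split; lra.
- move=> w p tw wp; have ps : p \in s by apply: Es; exists w.
  exists (index p s).
    by split; [rewrite index_mem|exists w => //; rewrite nth_index].
  by rewrite nth_index//; apply: ballxx; rewrite divr_gt0.
apply: (@le_trans _ _ (\esum_(j in `I_(size s)) N%:R%:E)).
  rewrite tE0; under eq_esum do rewrite powRr0 mulr1.
  by apply: le_esum_set => [j _|j []//]; rewrite lee_fin.
rewrite esum_fset//.
by rewrite -sumEFin (fsbig_ord _ _ (fun=> N%:R%:E)) lexx.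
Qed.

(** The uniform weights [#|I| ^- size u] are multiplicative with sum 1 on each level, so a cover has
    total weight at least 1. Words of length at least [n] weigh at most [#|I| ^- n] each, so at
    least [2 ^ n] of them are needed. *)
Lemma Mt_setT_pinfty : t = 0%R -> (2 <= #|I|)%N ->
  Mt X t [set: nat -> I] = +oo.
Proof.
move=> tE0 I2; apply/eqyP => A A0; set n := (Num.truncn A).+1.
apply: le_trans (Mtn_le_Mt X t n _).
apply: le_ereal_inf_tmp => _ [C [CI Ccov Cn] <-].
have b0 : (0 < #|I|%:R :> R)%R by rewrite ltr0n ltnW.
pose g u : R := (#|I|%:R ^- size u)%R.
have g0 u : (0 <= g u)%R by rewrite invr_ge0 exprn_ge0// ltW.
have gM u v : finite_words u -> finite_words v -> (g (u ++ v) <= 1 * g u * g v)%R.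
  by move=> _ _; rewrite mul1r /g size_cat exprD invfM.
have gS m : (0 < m)%N -> (1 <= \sum_(w : m.-tuple I) g w)%R.
  move=> _; rewrite (eq_bigr (fun=> #|I|%:R ^- m)%R); last first.
    by move=> w _; rewrite /g size_tuple.
  rewrite sumr_const card_tuple -[leRHS]mulr_natl natrX divff//.
  by rewrite expf_neq0// gt_eqF.
have [r [ur rC r1]] := cover_sum_ge1 ltr01 ler01 g0 gM gS CI
  (fun w => Ccov w Logic.I).
apply: le_trans (esum_ge_seq _ ur rC).
rewrite tE0; under eq_bigr do rewrite poweRe0.
rewrite sumEFin lee_fin big_const_seq count_predT iter_addr addr0.
have : (1 <= \sum_(i <- r) #|I|%:R ^- n :> R)%R.
  apply: (le_trans r1); rewrite !big_seq; apply: ler_sum => i /rC/Cn ni.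
  by rewrite mul1r lef_pV2 ?posrE ?exprn_gt0// ler_weXn2l// ler1n ltnW.
rewrite big_const_seq count_predT iter_addr addr0 -[leRHS]mulr_natl.
rewrite ler_pdivlMr ?exprn_gt0// mul1r; apply: le_trans.
rewrite (le_trans (ltW (truncnS_gt A)))// -/n -natrX ler_nat.
by rewrite (leq_trans (ltnW (ltn_expl n (ltnSn 1))))// leq_exp2r.
Qed.

Lemma Mt_setT_le N (c : \bar R) :
  (forall x, limit_set X x -> exists e : R, (0 < e)%R /\
    forall r, (0 < r < e)%R -> (counting (Zxr X x r) : \bar R) <= N%:R%:E) ->
  (forall k, Mt X t (tame N k) <= c) -> Mt X t [set: nat -> I] <= c.
Proof.
move=> Ncl tc.
rewrite (_ : [set: nat -> I] = \bigcup_k tame N k).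
  apply: caratheodory_nondecreasing_bigcup_le => //.
  - by move=> k; exact: caratheodory_tame.
  - exact: nondecreasing_tame.
apply/seteqP; split=> // w _; have [x wx] := exists_projects_to w.
have [|e [e0 ex]] := Ncl x; first by exists w.
(* This index [k] satisfies [1 / (k + 1) < e]. *)
exists (Num.truncn e^-1) => // x' r wx' /andP[r0 re] s us sZ.
have xx : [set x] x' by rewrite -wx wx'.
apply: counting_le_size us sZ; rewrite xx; apply: ex.
rewrite r0 (lt_trans re)// -[ltRHS]invrK ltf_pV2 ?posrE ?invr_gt0//.
exact: truncnS_gt.
Qed.

End moran_construction.

(** Any positive integer above the supremum serves as [N]. It is uniform in [x], while the
    admissible radii depend on [x]; this is why the sets [tame N k] carry the second index. *)
Lemma finite_clustering_bound (R : realType) (M : metricType R) (I : finType)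
    (X : seq I -> set M) : finite_clustering X ->
  exists N, (0 < N)%N /\ forall x, limit_set X x -> exists e : R, (0 < e)%R /\
    forall r, (0 < r < e)%R -> (counting (Zxr X x r) : \bar R) <= N%:R%:E.
Proof.
rewrite /finite_clustering; set s := ereal_sup _ => soo.
have [N [N0 sN]] : exists N, (0 < N)%N /\ s < N%:R%:E.
  case: s soo => [r _| |_] //; last by exists 1%N; rewrite ltNyr.
  by exists (Num.truncn r).+1; rewrite lte_fin truncnS_gt.
exists N; split=> // x Ex.
have : limf_esup (fun r : R => counting (Zxr X x r) : \bar R) 0^'+ < N%:R%:E.
  by apply: le_lt_trans sN; apply: ereal_sup_ubound; exists x.
rewrite limf_esupE => /ereal_inf_lt[_ [V V0 <-] VN].
have [e /= e0 eV] := (nbhs_ballP _ _).1 V0.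
exists e; split=> // r /andP[r0 re]; apply: le_trans (ltW VN).
apply: ereal_sup_ubound; exists r => //; apply: eV => //.
by rewrite /ball/= sub0r normrN gtr0_norm.
Qed.

Theorem proposition3p1 (R : realType) (M : metricType R) (I : finType)
    (X : seq I -> set M) (t : R) :
  (2 <= #|I|)%N ->
  wcmc X ->
  finite_clustering X ->
  (0 <= t)%R ->
  (0 <= pressure X t)%R ->
  0 < hausdorff_measure t (limit_set X) /\
  (hausdorff_measure t (limit_set X) < +oo <->
   Mt X t [set: nat -> I] < +oo).
Proof.
move=> I2 [Xcd [D [D1 [W1 W2 W3 W4]]]] fc t0 P0.
have I0 : (0 < #|I|)%N by exact: ltnW.
have Xc i : finite_words i -> compact (X i) by move=> /Xcd[].
have Xd i : finite_words i -> 0 < diam (X i) by move=> /Xcd[].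
have [N [N0 Ncl]] := finite_clustering_bound fc.
have [tE0|tn0] := eqVneq t 0%R.
  have Moo := Mt_setT_pinfty X tE0 I2.
  (* A finite limit set would make the net measure finite, contradicting [Moo]; hence the counting
     measure is infinite. *)
  suff -> : hausdorff_measure t (limit_set X) = +oo by rewrite Moo.
  rewrite /hausdorff_measure tE0 eqxx /counting ifF//; apply/negP.
  move=> /asboolP/finite_seqP[s Es].
  suff : Mt X t [set: nat -> I] < +oo by rewrite Moo.
  apply: (@le_lt_trans _ _ (\sum_(j < size s) N%:R)%:E); last exact: ltry.
  apply: (Mt_setT_le D1 Xc Xd W1 W2 W3 Ncl) => k.
  by apply: (Mt_tame_le_counting D1 Xc Xd W1 W2 W3 t0) => // x; rewrite Es.
have tgt0 : (0 < t)%R by rewrite lt_neqAle eq_sym tn0.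
have MH : Mt X t [set: nat -> I] <= N%:R%:E * hausdorff_measure t (limit_set X).
  apply: (Mt_setT_le D1 Xc Xd W1 W2 W3 Ncl) => k.
  exact: (Mt_tame_le_hausdorff D1 Xc Xd W1 W2 W3).
have M0 : 0 < Mt X t [set: nat -> I].
  (* The lower bound on [Mtn] already holds at [n = 0], and [Mt] dominates every [Mtn]. *)
  apply: lt_le_trans (Mtn_le_Mt X t 0%N _).
  apply: lt_le_trans (Mtn_setT_ge D1 Xc Xd W3 W4 t0 0%N I0 P0).
  by rewrite lte_fin invr_gt0 powR_gt0// (lt_le_trans ltr01).
have N0' : 0 < N%:R%:E :> \bar R by rewrite lte_fin ltr0n.
split; first by rewrite -(pmule_rgt0 _ N0'); exact: lt_le_trans MH.
split=> [Hoo|]; last first.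
  by apply: le_lt_trans; exact: (hausdorff_measure_le_Mt D1 Xc W1 W2 W3).
apply: le_lt_trans MH _; rewrite lte_mul_pinfty// ?lee_fin//.
Qed.
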